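(* Let $0<p<1$ be constant and let $H$ be an $\ell$-graph. Then $$\mathbb{P}\big(G^{(\ell)}(N,p)\text{ is induced-}H\text{-free}\big)=2^{-(h_p(H)+o(1))\binom{N}{\ell}} .$$
   Context: An $\ell$-graph is an $\ell$-uniform hypergraph; $[N]^{(\ell)}$ is the set of $\ell$-subsets of $[N]=\{1,\ldots,N\}$. $G^{(\ell)}(N,p)$ is the random $\ell$-graph on $[N]$ in which each $\ell$-set is an edge independently with probability $p$. An $\ell$-graph is induced-$H$-free if it has no induced subgraph isomorphic to $H$. The $o(1)$ term is as $N\to\infty$. A 2-coloured $\ell$-multigraph $J$ on vertex set $[N]$ is a pair of edge sets $J_R,J_B\subset[N]^{(\ell)}$ (possibly intersecting), called the red and blue edge sets. Write $H\subset J$ if there is an $\ell$-graph $H'$ isomorphic to $H$ with vertex set $W\subset[N]$ such that $E(H')\subset J_R$ and $W^{(\ell)}\setminus E(H')\subset J_B$. Define $$H_p(J)=-|J_R\setminus J_B|\log_2 p-|J_B\setminus J_R|\log_2(1-p),$$ $$\mathrm{hex}_p(H,N)=\min\{H_p(J): J \text{ a 2-coloured } \ell\text{-multigraph on }[N],\ J_R\cup J_B=[N]^{(\ell)},\ H\not\subset J\},$$ $$h_p(H)=\lim_{N\to\infty}\mathrm{hex}_p(H,N)\binom{N}{\ell}^{-1}$$ (this limit exists). *)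

(* Defs.v *)
From mathcomp Require Import all_boot all_order all_algebra.
From mathcomp Require Import all_classical all_reals all_analysis.

Set Implicit Arguments.
Unset Strict Implicit.
Unset Printing Implicit Defensive.

Import Order.TTheory GRing.Theory Num.Theory.
Import numFieldNormedType.Exports.

Local Open Scope ring_scope.

Section Hypergraphs.
Variable l : nat.

Definition lsubsets (T : finType) (W : {set T}) : {set {set T}} :=
  [set e : {set T} | e \subset W & #|e| == l].

(* A hypergraph on the vertex set T is given by its set of edges. *)
Definition lgraph (T : finType) (E : {set {set T}}) : bool :=
  E \subset lsubsets [set: T].

(* The hypergraph with vertex set W and edge set E is isomorphic to the
   hypergraph with vertex set V and edge set H. *)
Definition is_copy (V T : finType) (H : {set {set V}})
    (W : {set T}) (E : {set {set T}}) : bool :=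
  [exists f : {ffun V -> T},
    [&& injectiveb f, f @: [set: V] == W & E == [set f @: (e : {set V}) | e in H]]].

Definition induced_on (T : finType) (G : {set {set T}}) (W : {set T}) :=
  [set e in G | e \subset W].

Definition induced_free (V T : finType) (H : {set {set V}}) (G : {set {set T}}) :
    bool :=
  ~~ [exists W : {set T}, is_copy H W (induced_on G W)].

(* Throughout, a 2-coloured multigraph J is the pair (J.1, J.2) = (J_R, J_B). *)
Definition coloured_sub (V T : finType) (H : {set {set V}})
    (J : {set {set T}} * {set {set T}}) : bool :=
  [exists W : {set T}, exists E : {set {set T}},
    [&& is_copy H W E, E \subset J.1 & lsubsets W :\: E \subset J.2]].

End Hypergraphs.

Section RandomGraph.
Variables (R : realType) (l : nat) (p : R).

Definition Gnp_weight (N : nat) (G : {set {set 'I_N}}) : R :=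
  \prod_(e in lsubsets l [set: 'I_N]) (if e \in G then p else 1 - p).

Definition Gnp_prob (N : nat) (A : pred {set {set 'I_N}}) : R :=
  \sum_(G : {set {set 'I_N}} | lgraph l G && A G) Gnp_weight G.

(* Total mass 1 (S = set0), and the edge indicators are mutually independent
   with mean p. *)
Lemma Gnp_prob_edges (N : nat) (S : {set {set 'I_N}}) :
  lgraph l S -> Gnp_prob (fun G => S \subset G) = p ^+ #|S|.
Proof.
set L := lsubsets l [set: 'I_N] => SL.
have := @bigA_distr R 0 1 *%R +%R {set 'I_N}
  (fun e => if e \in L then p else 0)
  (fun e => if e \in L then (if e \in S then 0 else 1 - p) else 1).
rewrite (bigID (mem S)) /= (eq_bigr (fun=> p)) => [|e eS]; last first.
  by rewrite eS (fintype.subsetP SL) // addr0.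
rewrite prodr_const big1 => [|e eS]; last first.
  by rewrite (negbTE eS); case: ifP; rewrite ?add0r // addrC subrK.
rewrite mulr1 => ->.
rewrite /Gnp_prob big_mkcond /=; apply: eq_bigr => G _.
case: ifPn => [/andP[GL SG]|].
  rewrite /Gnp_weight -/L big_mkcond /=; apply: eq_bigr => e _.
  case: ifPn => eL; case: ifPn => eG //.
    by rewrite (contraNF (fintype.subsetP SG e) eG).
  by rewrite (fintype.subsetP GL _ eG) in eL.
rewrite negb_and => /orP[] /fintype.subsetPn[e e1 e2]; apply/esym.
  by rewrite (bigD1 e) //= e1 (negbTE e2) mul0r.
by rewrite (bigD1 e) //= (negbTE e2) e1 (fintype.subsetP SL) // mul0r.
Qed.

End RandomGraph.

Section Entropy.
Variables (R : realType) (l : nat) (p : R) (V : finType) (H : {set {set V}}).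

Definition log2 (x : R) : R := ln x / ln 2.

Definition H_p (N : nat) (J : {set {set 'I_N}} * {set {set 'I_N}}) : R :=
  - (#|J.1 :\: J.2|%:R * log2 p) - #|J.2 :\: J.1|%:R * log2 (1 - p).

Definition hex_p (N : nat) : \bar R :=
  \big[mine/+oo%E]_(J : {set {set 'I_N}} * {set {set 'I_N}} |
      (J.1 :|: J.2 == lsubsets l [set: 'I_N]) && ~~ coloured_sub l H J)
    (H_p J)%:E.

(* For an l-graph H, h_p is +oo exactly when H has fewer than l vertices: then
   H is contained in every J with N >= #|V|, and hex_p is a minimum over the
   empty set. *)
Definition h_p : \bar R :=
  lim ((fun N : nat => hex_p N * (('C(N, l)%:R : R)^-1)%:E)%E @ \oo)%classic.

End Entropy.

(* 2 ^ x for an extended real exponent. *)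
Definition pow2e (R : realType) (x : \bar R) : \bar R :=
  match x with
  | r%:E => (2 `^ r)%:E
  | +oo => +oo
  | -oo => 0
  end%E.

(* Main.v *)
Require Import Defs.
From mathcomp Require Import all_boot all_order all_algebra.
From mathcomp Require Import all_fingroup lra ring.
From mathcomp Require Import all_classical all_reals all_analysis.
From mathcomp Require Import fintype finset.
Import Order.TTheory GRing.Theory Num.Theory.
Import numFieldNormedType.Exports.
Local Open Scope ring_scope.

(** Write [P N] for the probability, [n] for ['C(N, l)], [f N] for
    [- log2 (P N) / n] and [g N] for [hex_p N / n].

    Lower bound for [P N].  For an optimal colouring [J] every hypergraph lying
    between [J_R \ J_B] and [J_R] is induced-[H]-free, and together these
    hypergraphs have probability [2 ^ (- H_p J)]; hence [f N <= g N]
    ([free_prob_ge]).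

    Upper bound.  For fixed [N'] and [eps], [f N >= g N' - eps] as soon as [N] is
    large ([ln_free_prob_le]).  The two bounds force [f] and [g] to converge to
    the same limit, the supremum of [g] ([cvg_sup_squeeze]).

    For the upper bound let [G] follow [G(N,p)] conditioned on being
    induced-[H]-free.  Fix a set [U] of [m] vertices and reveal the trace of [G],
    that is the edges meeting [U].  There are only [O(m / N) * n] of those, so the
    trace takes [2 ^ (o(1) * n)] values.  The conditional probability given the
    trace that [e] is an edge defines a colouring: [e] is red when this
    probability exceeds [delta] and blue when that of the complement does.

    The law of [G] is invariant under relabelling, so the mean square of this
    conditional probability depends on [m] alone.  It increases with [m] and is at
    most 1, hence for some bounded [m] it is almost unchanged by [#|V| - l] more
    vertices ([stable_level]).  Now let [W] be a set of [#|V|] vertices off [U] and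
    [e] an edge inside [W].  The other edges inside [W] all meet [W \ e], so they
    belong to the trace of [U] and [W \ e]; by stability they hardly influence [e].
    So the edges inside [W] are nearly independent given the trace, and a copy of
    [H] in the colouring on [W] would be an induced copy in [G] with probability
    about [delta ^ 'C(#|V|, l)].  As [G] has no such copy, the colouring seldom
    contains [H] on a given set ([expect_allowed_copy]).  Restricted to a fixed
    set of [N'] vertices it therefore costs at least [hex_p N'] up to a small
    error, and by symmetry the mean cost of each edge off [U] is at least [g N']
    up to a small error ([expect_cost_at_ge]).  Finally [G] obeys the colouring of its own trace up
    to [O(delta * n)] edges on average, and a comparison of its law with the
    product laws that obey these colourings ([ln_Gnp_prob_le]) shows that
    [- log2 (P N)] is at least the mean entropy of the colouring up to a small
    multiple of [n].

    All this needs [l <= #|V|].  Otherwise [H] has no edges, any [#|V|] vertices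
    span an induced copy, and both sides vanish for large [N]. *)

(** * Conditional expectation on a finite space *)

Section ConditionalExpectation.
Set Implicit Arguments.
Unset Strict Implicit.
Variables (R : realFieldType) (Om : finType) (mu : Om -> R).
Hypothesis mu_ge0 : forall x, 0 <= mu x.

Definition expect (f : Om -> R) : R := \sum_x mu x * f x.

(** The value of [k] is the information conditioned on.  On a class of measure
    zero the quotient is [0 / 0 = 0]. *)
Definition cond (K : eqType) (k : Om -> K) (f : Om -> R) (x : Om) : R :=
  (\sum_(y | k y == k x) mu y * f y) / (\sum_(y | k y == k x) mu y).

Definition measurable_for (K : eqType) (A : Type) (k : Om -> K) (g : Om -> A) :=
  forall x y, k x = k y -> g x = g y.

Lemma eq_expect f g : f =1 g -> expect f = expect g.
Proof. by move=> fg; apply: eq_bigr => x _; rewrite fg. Qed.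

Lemma expectD f g : expect (fun x => f x + g x) = expect f + expect g.
Proof. by rewrite -big_split /=; apply: eq_bigr => x _; rewrite mulrDr. Qed.

Lemma expectB f g : expect (fun x => f x - g x) = expect f - expect g.
Proof. by rewrite -sumrB /=; apply: eq_bigr => x _; rewrite mulrBr. Qed.

Lemma expectZ c f : expect (fun x => c * f x) = c * expect f.
Proof. by rewrite mulr_sumr; apply: eq_bigr => x _; rewrite mulrCA. Qed.

Lemma expect_sum (I : finType) (P : pred I) (F : I -> Om -> R) :
  expect (fun x => \sum_(i | P i) F i x) = \sum_(i | P i) expect (F i).
Proof.
by rewrite exchange_big /=; apply: eq_bigr => x _; rewrite mulr_sumr.
Qed.

Lemma le_expect f g : (forall x, f x <= g x) -> expect f <= expect g.
Proof. by move=> fg; apply: ler_sum => x _; rewrite ler_wpM2l. Qed.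

Lemma measurable_cond (K : eqType) (k : Om -> K) f :
  measurable_for k (cond k f).
Proof. by move=> x y kxy; rewrite /cond kxy. Qed.

Lemma cond_ge0 (K : eqType) (k : Om -> K) f x :
  (forall y, 0 <= f y) -> 0 <= cond k f x.
Proof.
move=> f0; apply: divr_ge0; apply: sumr_ge0 => y _ //.
by rewrite mulr_ge0.
Qed.

Lemma cond_le1 (K : eqType) (k : Om -> K) f x :
  (forall y, f y <= 1) -> cond k f x <= 1.
Proof.
move=> f1; rewrite /cond; set S := \sum_(_ | _) mu _.
have S0 : 0 <= S by apply: sumr_ge0.
have [->|Sn0] := eqVneq S 0; first by rewrite invr0 mulr0 ler01.
rewrite ler_pdivrMr ?lt_neqAle ?[0 == _]eq_sym ?Sn0 // mul1r.
by apply: ler_sum => y _; rewrite ler_piMr.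
Qed.

(** Classes of measure zero, where [cond] has no meaning, do not contribute to
    either side. *)
Lemma expect_cond (K : eqType) (k : Om -> K) f g : measurable_for k g ->
  expect (fun x => g x * cond k f x) = expect (fun x => g x * f x).
Proof.
move=> gk; rewrite /expect.
pose m x := \sum_(y | k y == k x) mu y.
transitivity (\sum_x \sum_(y | k y == k x) mu x / m y * (mu y * (g y * f y))).
  apply: eq_bigr => x _; rewrite /cond -/(m x) mulr_suml !mulr_sumr.
  apply: eq_bigr => y /eqP kyx.
  have -> : m y = m x by rewrite /m kyx.
  by rewrite (gk _ _ kyx); ring.
rewrite (exchange_big_dep predT) //=; apply: eq_bigr => y _.
rewrite -mulr_suml -mulr_suml.
have -> : \sum_(i | k y == k i) mu i = m y.
  by apply: eq_bigl => i; rewrite eq_sym.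
have [my0|my0] := eqVneq (m y) 0; last by rewrite divff // mul1r.
have /psumr_eq0P -> // : \sum_(z | k z == k y) mu z = 0 by [].
by rewrite !mul0r mulr0.
Qed.

(** Pythagoras: [cond k f] is the projection of [cond k' f] on the functions
    of [k], so that what finer information adds to the energy is exactly the
    squared distance between the two conditional expectations. *)
Lemma expect_sqr_condB (K K' : eqType) (k : Om -> K) (k' : Om -> K') f :
    (forall x y, k' x = k' y -> k x = k y) ->
  expect (fun x => (cond k' f x - cond k f x) ^+ 2) =
  expect (fun x => cond k' f x ^+ 2) - expect (fun x => cond k f x ^+ 2).
Proof.
move=> kk'; set c' := cond k' f; set c := cond k f.
have ck : measurable_for k c by exact: measurable_cond.
have ck' : measurable_for k' c by move=> x y /kk'; exact: ck.
have cross : expect (fun x => c x * c' x) = expect (fun x => c x ^+ 2).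
  rewrite (expect_cond f ck') -(expect_cond f ck).
  by apply: eq_expect => x; rewrite expr2.
transitivity (expect (fun x => c' x ^+ 2 + (c x ^+ 2 - 2 * (c x * c' x)))).
  by apply: eq_expect => x; ring.
rewrite expectD expectB expectZ cross; ring.
Qed.

(** Transport of structure: a bijection [phi] that preserves [mu] and matches the
    classes of [k] with those of [k'] carries one conditional expectation to the
    other. *)
Lemma cond_equivariant (K K' : eqType) (k : Om -> K) (k' : Om -> K') f f'
    (phi : Om -> Om) :
    injective phi -> (forall x, mu (phi x) = mu x) ->
    (forall x y, (k' (phi x) == k' (phi y)) = (k x == k y)) ->
    (forall x, f' (phi x) = f x) ->
  forall x, cond k' f' (phi x) = cond k f x.
Proof.
move=> phiI muphi kphi fphi x; rewrite /cond.
congr (_ / _); rewrite (reindex_inj phiI) /=.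
  by apply: eq_big => y; rewrite ?kphi // => _; rewrite muphi fphi.
by apply: eq_big => y; rewrite ?kphi // => _; rewrite muphi.
Qed.

Lemma expect_equivariant f (phi : Om -> Om) :
    injective phi -> (forall x, mu (phi x) = mu x) ->
  expect (fun x => f (phi x)) = expect f.
Proof.
move=> phiI muphi; rewrite /expect [RHS](reindex_inj phiI) /=.
by apply: eq_bigr => x _; rewrite muphi.
Qed.

End ConditionalExpectation.

(** * Exchangeable random hypergraphs *)

Section Relabelling.
Set Implicit Arguments.
Unset Strict Implicit.
Variable T : finType.
Implicit Types (s : {perm T}) (e U : {set T}) (G : {set {set T}}).

Definition relabel s G : {set {set T}} := [set s @: (e : {set T}) | e in G].

(** The edges meeting [U]: what is known of [G] once the vertices of [U] have been
    revealed. *)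
Definition trace U G : {set {set T}} := [set e in G | ~~ [disjoint e & U]].

Lemma mem_relabel s e G : (s @: e \in relabel s G) = (e \in G).
Proof. exact/mem_imset/imset_inj/perm_inj. Qed.

Lemma relabel_inj s : injective (relabel s).
Proof. exact/imset_inj/imset_inj/perm_inj. Qed.

Lemma imset_permKV s e : s @: ((s^-1)%g @: e) = e.
Proof.
by rewrite -imset_comp -[RHS]imset_id; apply: eq_imset => x /=; rewrite permKV.
Qed.

Lemma imset_permK s e : (s^-1)%g @: (s @: e) = e.
Proof. by rewrite -{2}(imset_permKV s^-1 e) invgK. Qed.

Lemma disjoint_imset s e U : [disjoint s @: e & s @: U] = [disjoint e & U].
Proof. by rewrite -!setI_eq0 -imsetI ?imset_eq0 // => x y _ _; exact: perm_inj. Qed.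

Lemma trace_relabel s U G : trace (s @: U) (relabel s G) = relabel s (trace U G).
Proof.
apply/setP => e; rewrite -(imset_permKV s e) mem_relabel !inE mem_relabel.
by rewrite disjoint_imset.
Qed.

Lemma trace_subset U U' G : U \subset U' -> trace U (trace U' G) = trace U G.
Proof.
move=> UU'; apply/setP => e; rewrite !inE -andbA; congr (_ && _).
by apply/andb_idl; apply: contraNN; exact: disjointWr.
Qed.

(** Symmetric groups are highly transitive; each step of the induction corrects
    the last image by a transposition that fixes the earlier ones. *)
Lemma perm_extend (t1 t2 : seq T) : uniq t1 -> uniq t2 -> size t1 = size t2 ->
  exists s : {perm T}, map s t1 = t2.
Proof.
elim: t1 t2 => [|x t1 IH] [|y t2] //=; first by exists 1%g.
move=> /andP[xt1 ut1] /andP[yt2 ut2] [/(IH _ ut1 ut2)[s st]].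
exists (s * tperm (s x) y)%g; rewrite permM tpermL; congr (_ :: _).
rewrite -[RHS]st; apply/eq_in_map => z zt1; rewrite permM tpermD //.
  by rewrite (inj_eq perm_inj); apply: contraNneq xt1 => ->.
by apply: contraNneq yt2 => ->; rewrite -st map_f.
Qed.

Lemma perm_extend_sets U U' e e' : #|U| = #|U'| -> #|e| = #|e'| ->
    [disjoint e & U] -> [disjoint e' & U'] ->
  exists s : {perm T}, s @: U = U' /\ s @: e = e'.
Proof.
move=> cU ce deU deU'.
have ucat (A B : {set T}) : [disjoint B & A] -> uniq (enum A ++ enum B).
  move=> dBA; rewrite cat_uniq !enum_uniq /= andbT; apply/hasPn => x.
  rewrite !mem_enum => xB.
  by apply: contraTN xB => xA; rewrite (disjointFl dBA xA).
have [|s] := perm_extend (ucat _ _ deU) (ucat _ _ deU').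
  by rewrite !size_cat -!cardE cU ce.
rewrite map_cat => /eqP; rewrite eqseq_cat ?size_map -?cardE // => /andP[].
move=> /eqP sU /eqP se; exists s; split; apply/setP => x.
  by rewrite -[RHS]mem_enum -sU; apply/imsetP/mapP => -[y yU ->]; exists y;
    rewrite ?mem_enum // -mem_enum.
by rewrite -[RHS]mem_enum -se; apply/imsetP/mapP => -[y yU ->]; exists y;
  rewrite ?mem_enum // -mem_enum.
Qed.

End Relabelling.

Lemma pigeonhole_increment (R : realFieldType) (a : nat -> R) (K : nat) :
    (0 < K)%N -> (forall j, (j <= K)%N -> 0 <= a j <= 1) ->
  exists2 j, (j < K)%N & a j.+1 - a j <= K%:R^-1.
Proof.
move=> K0 a01; apply: contrapT => nex.
have big j : (j < K)%N -> K%:R^-1 < a j.+1 - a j.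
  by move=> jK; rewrite ltNge; apply/negP => h; apply: nex; exists j.
have : \sum_(0 <= j < K) K%:R^-1 < \sum_(0 <= j < K) (a j.+1 - a j).
  rewrite !big_mkord; apply: ltr_sum => [|[j jK] _]; last exact: big.
  by apply/hasP; exists (Ordinal K0); rewrite ?mem_index_enum.
rewrite telescope_sumr // sumr_const_nat subn0 -[X in X < _]mulr_natl.
rewrite divff ?pnatr_eq0 -?lt0n //.
have /andP[_ aK] := a01 K (leqnn K); have /andP[a0 _] := a01 0 (leq0n K).
by rewrite ltNge; lra.
Qed.

Section Exchangeable.
Set Implicit Arguments.
Unset Strict Implicit.
Variables (R : realFieldType) (T : finType) (mu : {set {set T}} -> R).
Hypothesis mu_ge0 : forall G, 0 <= mu G.
Hypothesis mu_sum1 : \sum_G mu G = 1.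
Hypothesis mu_exch : forall (s : {perm T}) G, mu (relabel s G) = mu G.
Implicit Types (U e : {set T}) (G : {set {set T}}).

Definition edge_prob U e : {set {set T}} -> R :=
  cond mu (trace U) (fun G => (e \in G)%:R).

Definition energy U e : R := expect mu (fun G => edge_prob U e G ^+ 2).

Lemma edge_prob_ge0 U e G : 0 <= edge_prob U e G.
Proof. by apply: cond_ge0 => // G'; rewrite ler0n. Qed.

Lemma edge_prob_le1 U e G : edge_prob U e G <= 1.
Proof. by apply: cond_le1 => // G'; rewrite lern1 leq_b1. Qed.

Lemma edge_prob_relabel (s : {perm T}) U e G :
  edge_prob (s @: U) (s @: e) (relabel s G) = edge_prob U e G.
Proof.
apply: (cond_equivariant (phi := relabel s)) => //.
- exact: relabel_inj.
- by move=> A B; rewrite !trace_relabel (inj_eq (@relabel_inj _ s)).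
- by move=> A; rewrite mem_relabel.
Qed.

Lemma expect_relabel (s : {perm T}) (f : {set {set T}} -> R) :
  expect mu (fun G => f (relabel s G)) = expect mu f.
Proof. by apply: expect_equivariant => //; exact: relabel_inj. Qed.

Lemma energy_eq U U' e e' : #|U| = #|U'| -> #|e| = #|e'| ->
    [disjoint e & U] -> [disjoint e' & U'] -> energy U e = energy U' e'.
Proof.
move=> cU ce deU deU'; have [s [<- <-]] := perm_extend_sets cU ce deU deU'.
rewrite /energy -[RHS](expect_relabel s).
by apply: eq_expect => G; rewrite edge_prob_relabel.
Qed.

Lemma energy_ge0 U e : 0 <= energy U e.
Proof. by apply: sumr_ge0 => G _; rewrite mulr_ge0 // sqr_ge0. Qed.

Lemma energy_le1 U e : energy U e <= 1.
Proof.
rewrite -mu_sum1; apply: ler_sum => G _; rewrite ler_piMr //.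
by rewrite expr_le1 ?edge_prob_le1 ?edge_prob_ge0.
Qed.

(** The energy depends only on the number of revealed vertices, increases with
    it and stays below 1; so among [K] successive steps of [k] vertices one
    hardly changes the conditional probabilities. *)
Lemma stable_level (l k K : nat) : (0 < K)%N -> (K * k + l <= #|T|)%N ->
  exists2 m, (m + k <= K * k)%N &
    forall U U' e, U \subset U' -> #|U| = m -> #|U'| = (m + k)%N ->
      #|e| = l -> [disjoint e & U'] ->
      expect mu (fun G => (edge_prob U' e G - edge_prob U e G) ^+ 2)
        <= K%:R^-1.
Proof.
move=> K0 room.
(* Any increasing chain with steps of [k] vertices, together with one edge off the
   whole chain, computes the energy at each level. *)
pose chain j : {set T} := [set x in take (j * k) (enum T)].
pose e0 : {set T} := [set x in drop (#|T| - l) (enum T)].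
have card_chain j : (j <= K)%N -> #|chain j| = (j * k)%N.
  move=> jK; rewrite cardsE (card_uniqP (take_uniq _ (enum_uniq _))) size_take.
  rewrite -cardE; case: ltnP => // h; apply/eqP; rewrite eqn_leq h.
  apply: leq_trans room; apply: (leq_trans _ (leq_addr _ _)).
  by rewrite leq_mul2r jK orbT.
have card_e0 : #|e0| = l.
  rewrite cardsE (card_uniqP (drop_uniq _ (enum_uniq _))) size_drop -cardE.
  by rewrite subKn // (leq_trans _ room) // leq_addl.
have e0chain j : (j <= K)%N -> [disjoint e0 & chain j].
  move=> jK; apply/pred0P => x /=; rewrite !inE; apply/negP => /andP[xd xt].
  have := enum_uniq T; rewrite -(cat_take_drop (#|T| - l) (enum T)) cat_uniq.
  case/and3P => _ /hasPn /(_ x xd) /negP h _; apply: h => /=.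
  have jkT : (j * k <= #|T| - l)%N.
    by rewrite leq_subRL; last exact: leq_trans (leq_addl _ _) room;
      rewrite addnC (leq_trans _ room) // leq_add2r leq_mul2r jK orbT.
  by rewrite -(take_takel (enum T) jkT) in xt; exact: mem_take xt.
have [j jK incr] : exists2 j, (j < K)%N &
    energy (chain j.+1) e0 - energy (chain j) e0 <= K%:R^-1.
  by apply: pigeonhole_increment => // j _; rewrite energy_ge0 energy_le1.
exists (j * k)%N; first by rewrite addnC -mulSn leq_mul2r jK orbT.
move=> U U' e UU' cU cU' ce deU'.
rewrite expect_sqr_condB //; last first.
  by move=> G G' GG'; rewrite -(trace_subset G UU') GG' trace_subset.
apply: le_trans incr; rewrite le_eqVlt; apply/orP; left; apply/eqP.
congr (_ - _); apply: energy_eq; rewrite ?ce ?card_e0 ?e0chain //.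
- by rewrite card_chain // cU' mulSn addnC.
- by rewrite card_chain ?cU // ltnW.
- exact: disjointWr UU' deU'.
- by rewrite ltnW.
Qed.

End Exchangeable.

(** * The colouring by conditional edge probabilities *)

Section ConditionalColouring.
Set Implicit Arguments.
Unset Strict Implicit.
Variables (R : realFieldType) (T : finType) (mu : {set {set T}} -> R).
Hypothesis mu_ge0 : forall G, 0 <= mu G.
Hypothesis mu_sum1 : \sum_G mu G = 1.
Variables (U : {set T}) (delta : R).
Hypothesis delta_ge0 : 0 <= delta.
Hypothesis delta_le1 : delta <= 1.
Implicit Types (e : {set T}) (G : {set {set T}}).

(** Red ([true]) stands for an edge and blue ([false]) for a non-edge. *)
Definition colour_prob (b : bool) (x : R) : R := if b then x else 1 - x.

(** Edges meeting [U] get both colours: they are known exactly, but too few to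
    matter, and with both colours they cost nothing. *)
Definition allowed (b : bool) e G : bool :=
  ~~ [disjoint e & U] || (delta < colour_prob b (edge_prob mu U e G)).

Lemma measurable_allowed b e : measurable_for (trace U) (allowed b e).
Proof.
by move=> G G' GG'; rewrite /allowed /edge_prob (measurable_cond mu _ GG').
Qed.

Variables (l : nat) (V : finType) (H : {set {set V}}) (f : V -> T) (eta : R).
Hypothesis eta_gt0 : 0 < eta.
Hypothesis f_inj : injective f.
Hypothesis fU : [disjoint f @: [set: V] & U].
Hypothesis stable : forall (U' e : {set T}),
  U \subset U' -> #|U'| = (#|U| + (#|V| - l))%N ->
  #|e| = l -> [disjoint e & U'] ->
  expect mu (fun G => (edge_prob mu U' e G - edge_prob mu U e G) ^+ 2)
    <= eta ^+ 2.

Let LV := lsubsets l [set: V].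
Let B G : R := [forall e in LV, allowed (e \in H) (f @: (e : {set V})) G]%:R.
Let X (e : {set V}) G : R := ((f @: e \in G) == (e \in H))%:R.

(** All edges of the copy other than [f @: e] meet the rest of its vertices.
    Once those are revealed together with [U] only [f @: e] is random, and by
    stability its probability is close to what it was given [U] alone, which on
    the event [B] is at least [delta].  So each edge costs a factor [delta] and an
    error [eta]. *)
Lemma expect_allowed_edges (s : seq {set V}) : uniq s -> {subset s <= LV} ->
  delta ^+ size s * expect mu B - (size s)%:R * eta <=
  expect mu (fun G => B G * \prod_(e <- s) X e G).
Proof.
elim: s => [_ _|e s IH /= /andP[es us] sLV].
  rewrite expr0 mul1r mul0r subr0 le_eqVlt; apply/orP; left; apply/eqP.
  by apply: eq_expect => G; rewrite big_nil mulr1.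
have {}IH := IH us (fun x xs => sLV x (mem_behead (s := e :: s) xs)).
have eLV : e \in LV by apply: sLV; rewrite mem_head.
have ce : #|e| = l by move: eLV; rewrite inE => /andP[_ /eqP].
pose Y G := B G * \prod_(e' <- s) X e' G.
have B01 G : 0 <= B G <= 1 by rewrite /B; case: [forall _ in _, _]; rewrite ?lexx ler01.
have Y01 G : 0 <= Y G <= 1.
  have /andP[B0 B1] := B01 G.
  have P0 : 0 <= \prod_(e' <- s) X e' G by apply: prodr_ge0 => e' _; exact: ler0n.
  have P1 : \prod_(e' <- s) X e' G <= 1.
    by apply: prodr_ile1 => e' _; rewrite ler0n lern1 leq_b1.
  by rewrite mulr_ge0 // mulr_ile1.
pose U' := U :|: (f @: [set: V] :\: f @: e).
have feU' : [disjoint f @: e & U'].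
  rewrite -setI_eq0 setIUr setU_eq0 !setI_eq0.
  rewrite (disjointWl (imsetS f (subsetT e)) fU) disjoint_sym -setI_eq0.
  by rewrite setDE -setIA [~: _ :&: _]setIC setICr setI0 eqxx.
have cU' : #|U'| = (#|U| + (#|V| - l))%N.
  rewrite cardsU.
  have -> : U :&: (f @: [set: V] :\: f @: e) = set0.
    apply/eqP; rewrite setI_eq0 disjoint_sym.
    exact: disjointWl (subsetDl _ _) fU.
  rewrite cards0 subn0 cardsD (setIidPr _) ?imsetS ?subsetT //.
  by rewrite !card_imset // cardsT ce.
have Ymeas : measurable_for (trace U') Y.
  move=> G G' GG'.
  have tU : trace U G = trace U G'.
    have UU' : U \subset U' by exact: subsetUl.
    by rewrite -(trace_subset G UU') GG' trace_subset.
  congr (_ * _).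
    rewrite /B; congr (_%:R); congr nat_of_bool; apply: eq_forallb => e'.
    by rewrite (measurable_allowed _ _ tU).
  rewrite !big_seq; apply: eq_bigr => e' e's; rewrite /X.
  suff /setP/(_ (f @: e')) : trace U' G = trace U' G'.
    rewrite !inE; suff -> : ~~ [disjoint f @: e' & U'] by rewrite !andbT => ->.
    have : ~~ (e' \subset e).
      apply: contraNN es => e'e; suff <- : e' = e by [].
      apply/eqP; rewrite eqEcard e'e ce.
      by move: (sLV e'); rewrite inE e's orbT inE => /(_ isT) /andP[_ /eqP ->] /=.
    case/subsetPn => v ve' ve; apply/pred0Pn; exists (f v) => /=.
    by rewrite imset_f //= !inE (mem_imset _ _ f_inj) ve imset_f ?inE ?orbT.
  exact: GG'.
(* [X e] may be replaced by its conditional expectation given [trace U']; then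
   passing from [U'] to [U] costs at most [eta] in mean, by the inequality of
   arithmetic and geometric means and the bound on the variance. *)
pose c G := edge_prob mu U (f @: e) G; pose c' G := edge_prob mu U' (f @: e) G.
have step : expect mu (fun G => B G * \prod_(e' <- e :: s) X e' G) =
            expect mu (fun G => Y G * colour_prob (e \in H) (c' G)).
  transitivity (expect mu (fun G =>
      Y G * colour_prob (e \in H) (f @: e \in G)%:R)).
    apply: eq_expect => G; rewrite big_cons mulrCA mulrC; congr (_ * _).
    by rewrite /X /colour_prob; case: (_ \in H); case: (_ \in G);
      rewrite ?subrr ?subr0.
  have YX := expect_cond mu_ge0 (fun G => (f @: e \in G)%:R) Ymeas.
  rewrite /colour_prob; case: (_ \in H); first by rewrite -YX.
  transitivity (expect mu Y - expect mu (fun G => Y G * (f @: e \in G)%:R)).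
    by rewrite -expectB; apply: eq_expect => G; rewrite mulrBr mulr1.
  by rewrite -YX -expectB; apply: eq_expect => G; rewrite mulrBr mulr1.
rewrite step.
have lower G : delta * Y G - (eta / 2 + (c' G - c G) ^+ 2 / (2 * eta)) <=
               Y G * colour_prob (e \in H) (c' G).
  have /andP[Y0 Y1] := Y01 G.
  have amgm : `|c' G - c G| <= eta / 2 + (c' G - c G) ^+ 2 / (2 * eta).
    rewrite -real_normK ?num_real //; set d := `|_|.
    suff : 0 <= (d - eta) ^+ 2 / (2 * eta).
      suff -> : (d - eta) ^+ 2 / (2 * eta) =
        eta / 2 + d ^+ 2 / (2 * eta) - d by rewrite subr_ge0.
      by field; rewrite gt_eqF.
    by rewrite divr_ge0 ?sqr_ge0 // mulr_ge0 // ltW.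
  have dist : Y G * colour_prob (e \in H) (c G) - `|c' G - c G| <=
              Y G * colour_prob (e \in H) (c' G).
    rewrite lerBlDr -lerBlDl -mulrBr.
    apply: (@le_trans _ _ (Y G * `|c' G - c G|)); last by rewrite ler_piMl.
    rewrite ler_wpM2l // /colour_prob; case: (_ \in H).
      by rewrite -normrN opprB ler_norm.
    by apply: le_trans (ler_norm _); lra.
  have onB : delta * Y G <= Y G * colour_prob (e \in H) (c G).
    rewrite mulrC /Y /B; case: (boolP [forall _ in _, _]); last by rewrite !mul0r.
    move=> /forall_inP/(_ e eLV); rewrite /allowed.
    rewrite (disjointWl (imsetS f (subsetT e)) fU) /= => /ltW dc.
    by rewrite ler_wpM2l // mul1r prodr_ge0 // => e' _; exact: ler0n.
  lra.
apply: le_trans (le_expect mu_ge0 lower).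
have -> : expect mu (fun G => delta * Y G -
    (eta / 2 + (c' G - c G) ^+ 2 / (2 * eta))) =
  delta * expect mu Y - (eta / 2 + expect mu (fun G => (c' G - c G) ^+ 2) / (2 * eta)).
  rewrite expectB expectZ; congr (_ - _).
  rewrite (expectD mu (fun=> eta / 2) (fun G => (c' G - c G) ^+ 2 / (2 * eta))).
  congr (_ + _); first by rewrite /expect -mulr_suml mu_sum1 mul1r.
  by rewrite [RHS]mulrC -expectZ; apply: eq_expect => G; rewrite mulrC.
have var : expect mu (fun G => (c' G - c G) ^+ 2) / (2 * eta) <= eta / 2.
  rewrite ler_pdivrMr ?mulr_gt0 //.
  have -> : eta / 2 * (2 * eta) = eta ^+ 2 by field.
  by apply: stable => //; [exact: subsetUl | rewrite card_imset].
have shrink : delta * ((size s)%:R * eta) <= (size s)%:R * eta.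
  by rewrite ler_piMl // mulr_ge0 // ltW.
have := ler_wpM2l delta_ge0 IH; rewrite mulrBr exprS -mulrA -natr1 mulrDl mul1r.
rewrite -/Y; lra.
Qed.

(** If the copy is induced in no hypergraph of the support, then the product of
    the indicators [X e] has mean zero in the previous bound. *)
Lemma expect_allowed_copy :
    (forall G, mu G != 0 -> exists2 e, e \in LV & (f @: e \in G) != (e \in H)) ->
  delta ^+ #|LV| * expect mu B <= #|LV|%:R * eta.
Proof.
move=> free; rewrite -subr_le0 cardE.
apply: le_trans (expect_allowed_edges (enum_uniq _) _) _.
  by move=> e; rewrite mem_enum.
rewrite le_eqVlt; apply/orP; left; apply/eqP; apply: big1 => G _.
have [->|/free[e eLV ne]] := eqVneq (mu G) 0; first by rewrite mul0r.
rewrite (big_rem e) ?mem_enum //= {1}/X (negbTE ne).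
by rewrite mul0r !mulr0.
Qed.

End ConditionalColouring.

(** * The mean cost of an edge *)

(** A copy in [J] seen from the vertices of [H], where colours can be checked edge
    by edge. *)
Lemma coloured_sub_embedding (l : nat) (V W : finType) (H : {set {set V}})
    (J : {set {set W}} * {set {set W}}) : coloured_sub l H J ->
  exists2 g : {ffun V -> W}, injective g &
    forall e, e \in lsubsets l [set: V] ->
      g @: e \in if e \in H then J.1 else J.2.
Proof.
case/existsP => A /existsP[E] /and3P[/existsP[g]].
case/and3P => /injectiveP gI /eqP gA /eqP -> HJ1 LJ2; exists g => // e.
rewrite inE => /andP[_ /eqP ce]; case: ifPn => eH.
  by apply: (fintype.subsetP HJ1); exact: imset_f.
apply: (fintype.subsetP LJ2); rewrite !inE -gA imsetS ?subsetT //=.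
rewrite card_imset // ce eqxx andbT.
by rewrite (mem_imset _ _ (imset_inj gI)).
Qed.

Section EdgeCost.
Set Implicit Arguments.
Unset Strict Implicit.
Variables (R : realType) (p : R).
Hypotheses (p_gt0 : 0 < p) (p_lt1 : p < 1).

(** The summand of [H_p] for an edge that is red if [r] and blue if [b], in natural
    logarithms. *)
Definition edge_cost (r b : bool) : R :=
  if r && ~~ b then - ln p else if b && ~~ r then - ln (1 - p) else 0.

Lemma edge_cost_ge0 r b : 0 <= edge_cost r b.
Proof.
rewrite /edge_cost; case: r; case: b => //=; rewrite oppr_ge0 ln_le0 //.
  exact: ltW.
by rewrite gerBl ltW.
Qed.

Lemma sum_edge_cost (l N : nat) (J : {set {set 'I_N}} * {set {set 'I_N}}) :
    J.1 :|: J.2 = lsubsets l [set: 'I_N] ->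
  \sum_(e in lsubsets l [set: 'I_N]) edge_cost (e \in J.1) (e \in J.2)
    = H_p p J * ln 2.
Proof.
move=> JL.
have split_cost e : edge_cost (e \in J.1) (e \in J.2) =
    (if e \in J.1 :\: J.2 then - ln p else 0) +
    (if e \in J.2 :\: J.1 then - ln (1 - p) else 0).
  by rewrite /edge_cost !inE; case: (_ \in J.1); case: (_ \in J.2);
    rewrite /= ?addr0 ?add0r.
under eq_bigr do rewrite split_cost.
have sub1 : J.1 :\: J.2 \subset lsubsets l [set: 'I_N].
  by rewrite -JL subDset setUCA subsetUl.
have sub2 : J.2 :\: J.1 \subset lsubsets l [set: 'I_N].
  by rewrite -JL subDset setUA subsetUr.
have count (A : {set {set 'I_N}}) c : A \subset lsubsets l [set: 'I_N] ->
    \sum_(e in lsubsets l [set: 'I_N]) (if e \in A then c else 0) = #|A|%:R * c :> R.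
  move=> AL; rewrite -big_mkcondr mulr_natl -sumr_const /=; apply: eq_bigl => e.
  by apply/andb_idl; exact: fintype.subsetP.
rewrite big_split /= !count // /H_p /log2 mulrBl mulNr -!mulrA mulVf ?gt_eqF //.
  by rewrite !mulr1 !mulrN.
by rewrite ln_gt0 // ltr1n.
Qed.

Variables (T : finType) (mu : {set {set T}} -> R).
Hypothesis mu_ge0 : forall G, 0 <= mu G.
Hypothesis mu_sum1 : \sum_G mu G = 1.
Hypothesis mu_exch : forall (s : {perm T}) G, mu (relabel s G) = mu G.
Variables (U : {set T}) (delta : R).
Implicit Types (e : {set T}) (G : {set {set T}}).


Definition cost_at e G : R :=
  edge_cost (allowed mu U delta true e G) (allowed mu U delta false e G).

(** Some permutation fixes [U] and maps [e] to [e']. *)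
Lemma expect_cost_at_eq e e' : #|e| = #|e'| ->
    [disjoint e & U] -> [disjoint e' & U] ->
  expect mu (cost_at e) = expect mu (cost_at e').
Proof.
move=> ce deU deU'; have [s [sU <-]] := perm_extend_sets erefl ce deU deU'.
rewrite -[RHS](expect_relabel mu_exch s); apply: eq_expect => G.
have allowed_relabel b : allowed mu U delta b (s @: e) (relabel s G) =
    allowed mu U delta b e G.
  by rewrite /allowed -{1 2}sU disjoint_imset edge_prob_relabel.
by rewrite /cost_at !allowed_relabel.
Qed.

Variables (l : nat) (V : finType) (H : {set {set V}}) (eta : R).
Hypothesis delta_gt0 : 0 < delta.
Hypothesis delta_lt2 : delta < 2^-1.
Hypothesis eta_gt0 : 0 < eta.
Hypothesis stable : forall (U' e : {set T}),
  U \subset U' -> #|U'| = (#|U| + (#|V| - l))%N ->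
  #|e| = l -> [disjoint e & U'] ->
  expect mu (fun G => (edge_prob mu U' e G - edge_prob mu U e G) ^+ 2)
    <= eta ^+ 2.
Hypothesis free : forall G, mu G != 0 -> forall h : V -> T, injective h ->
  exists2 e : {set V}, e \in lsubsets l [set: V] & (h @: e \in G) != (e \in H).

Lemma allowed_either e G :
  allowed mu U delta true e G || allowed mu U delta false e G.
Proof.
rewrite /allowed /colour_prob; case: [disjoint _ & _] => //=.
set c := edge_prob mu U e G; apply/orP.
by case: (ltP delta c) => h; [left | right; move: delta_lt2 h; lra].
Qed.

(** Pull the colouring back along [i].  By a union bound over the maps from [V] to
    ['I_N'] it seldom contains [H], and otherwise it costs at least [x].  All its
    ['C(N', l)] edges have the same mean cost. *)
Lemma expect_cost_at_ge (N' : nat) (i : 'I_N' -> T) (x : R) e0 :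
    injective i -> [disjoint i @: [set: 'I_N'] & U] -> 0 <= x ->
    (forall J : {set {set 'I_N'}} * {set {set 'I_N'}},
       J.1 :|: J.2 = lsubsets l [set: 'I_N'] -> ~~ coloured_sub l H J ->
       x <= H_p p J * ln 2) ->
    #|e0| = l -> [disjoint e0 & U] ->
  x * (1 - #|{ffun V -> 'I_N'}|%:R *
           (#|lsubsets l [set: V]|%:R * eta / delta ^+ #|lsubsets l [set: V]|))
    <= 'C(N', l)%:R * expect mu (cost_at e0).
Proof.
move=> iI iU x0 xmin ce0 de0.
set L' := lsubsets l [set: 'I_N']; set LV := lsubsets l [set: V].
pose J G := ([set e in L' | allowed mu U delta true (i @: e) G],
             [set e in L' | allowed mu U delta false (i @: e) G]).
have JL G : (J G).1 :|: (J G).2 = L'.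
  by apply/setP => e; rewrite !inE -andb_orr allowed_either andbT.
have sum_cost : 'C(N', l)%:R * expect mu (cost_at e0) =
    expect mu (fun G => H_p p (J G) * ln 2).
  transitivity (\sum_(e in L') expect mu (cost_at (i @: e))).
    rewrite (eq_bigr (fun=> expect mu (cost_at e0))) => [|e].
      by rewrite sumr_const cards_draws cardsT card_ord mulr_natl.
    rewrite inE => /andP[_ /eqP ce]; apply: expect_cost_at_eq => //.
      by rewrite card_imset // ce ce0.
    exact: disjointWl (imsetS i (subsetT e)) iU.
  rewrite -expect_sum; apply: eq_expect => G; rewrite -(sum_edge_cost (JL G)).
  by apply: eq_bigr => e eL; rewrite /cost_at inE eL /= inE eL.
rewrite sum_cost.
pose B (g : {ffun V -> 'I_N'}) G : R :=
  [forall e in LV, allowed mu U delta (e \in H) ((i \o g) @: (e : {set V})) G]%:R.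
have cost_ge G : x * (1 - \sum_(g : {ffun V -> 'I_N'} | injectiveb g) B g G) <=
    H_p p (J G) * ln 2.
  have B0 (g : {ffun V -> 'I_N'}) : 0 <= B g G by exact: ler0n.
  have [sub|] := boolP (coloured_sub l H (J G)); last first.
    move/(xmin _ (JL G)); apply: le_trans; rewrite ler_piMr // gerBl.
    by apply: sumr_ge0.
  apply: (@le_trans _ _ 0).
    rewrite mulr_ge0_le0 // subr_le0.
    have [g gI gJ] := coloured_sub_embedding sub.
    rewrite (bigD1 g) /=; last exact/injectiveP.
    have -> : B g G = 1.
      rewrite /B; suff -> : [forall e in LV, allowed mu U delta (e \in H)
        ((i \o g) @: (e : {set V})) G] by [].
      apply/forall_inP => e /gJ; rewrite imset_comp.
      by case: (e \in H); rewrite !inE => /andP[].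
    by rewrite lerDl sumr_ge0.
  by rewrite -(sum_edge_cost (JL G)) sumr_ge0 // => e _; exact: edge_cost_ge0.
apply: le_trans (le_expect mu_ge0 cost_ge).
rewrite expectZ ler_wpM2l // expectB /expect.
under [in leRHS]eq_bigr do rewrite mulr1.
rewrite mu_sum1 lerD2l lerN2 -/(expect mu _) expect_sum.
apply: (@le_trans _ _ (\sum_(g : {ffun V -> 'I_N'} | injectiveb g)
    (#|LV|%:R * eta / delta ^+ #|LV|))); last first.
  rewrite sumr_const -[leLHS]mulr_natl ler_wpM2r ?ler_nat ?max_card //.
  by rewrite divr_ge0 ?mulr_ge0 ?exprn_ge0 // ltW.
apply: ler_sum => g /injectiveP gI.
rewrite ler_pdivlMr ?exprn_gt0 // mulrC.
apply: (@expect_allowed_copy _ _ mu) => //.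
- exact: ltW.
- by rewrite ltW // (lt_trans delta_lt2) // invf_lt1 ?ltr1n.
- by apply: inj_comp.
- by rewrite imset_comp; apply: disjointWl iU; exact: imsetS (subsetT _).
- by move=> G /free; apply; apply: inj_comp.
Qed.

End EdgeCost.

(** * The change of measure *)

Section Conditioned.
Set Implicit Arguments.
Unset Strict Implicit.
Variables (R : realType) (l N : nat) (p : R).
Hypotheses (p_gt0 : 0 < p) (p_lt1 : p < 1).
Variable A : pred {set {set 'I_N}}.
Implicit Types (e : {set 'I_N}) (G : {set {set 'I_N}}).

Local Notation L := (lsubsets l [set: 'I_N]).
Local Notation Z := (Gnp_prob l p A).

Lemma sum_lgraph_prod (q : {set 'I_N} -> bool -> R) :
  \sum_(G : {set {set 'I_N}} | lgraph l G) \prod_(e in L) q e (e \in G) =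
  \prod_(e in L) (q e true + q e false).
Proof.
have := @bigA_distr R 0 1 *%R +%R {set 'I_N}
  (fun e => if e \in L then q e true else 0)
  (fun e => if e \in L then q e false else 1).
rewrite (bigID (mem L)) /= [X in _ * X]big1 ?mulr1 => [|e eL]; last first.
  by rewrite (negbTE eL) add0r.
under eq_bigr => e eL do rewrite eL.
move=> ->; rewrite big_mkcond; apply: eq_bigr => G _.
case: ifPn => [GL|/fintype.subsetPn[e eG eL]]; last first.
  by apply/esym; rewrite (bigD1 e) //= eG (negbTE eL) mul0r.
rewrite big_mkcond; apply: eq_bigr => e _; case: ifPn => eL.
  by case: (e \in G).
by case: ifPn => // eG; rewrite (fintype.subsetP GL _ eG) in eL.
Qed.

Lemma Gnp_weight_ge0 G : 0 <= Gnp_weight l p G.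
Proof. by apply: prodr_ge0 => e _; case: ifP => _; rewrite ltW // subr_gt0. Qed.

Definition conditioned G : R :=
  (if lgraph l G && A G then Gnp_weight l p G else 0) / Z.

Lemma relabel_lsubsets (s : {perm 'I_N}) e : (s @: e \in L) = (e \in L).
Proof. by rewrite !inE !subsetT card_imset //; exact: perm_inj. Qed.

Lemma lgraph_relabel (s : {perm 'I_N}) G : lgraph l (relabel s G) = lgraph l G.
Proof.
apply/fintype.subsetP/fintype.subsetP => GL e eG.
  by rewrite -(relabel_lsubsets s); apply: GL; rewrite mem_relabel.
by case/imsetP: eG => e' /GL e'L ->; rewrite relabel_lsubsets.
Qed.

Lemma Gnp_weight_relabel (s : {perm 'I_N}) G :
  Gnp_weight l p (relabel s G) = Gnp_weight l p G.
Proof.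
rewrite /Gnp_weight (reindex_inj (imset_inj (@perm_inj _ s))) /=.
by apply: eq_big => e; rewrite ?relabel_lsubsets // mem_relabel.
Qed.

Lemma conditioned_exch : (forall (s : {perm 'I_N}) G, A (relabel s G) = A G) ->
  forall (s : {perm 'I_N}) G, conditioned (relabel s G) = conditioned G.
Proof.
by move=> As s G; rewrite /conditioned lgraph_relabel As Gnp_weight_relabel.
Qed.

Hypothesis Z_gt0 : 0 < Z.

Lemma conditioned_ge0 G : 0 <= conditioned G.
Proof.
by rewrite divr_ge0 // ?(ltW Z_gt0) //; case: ifP => // _; exact: Gnp_weight_ge0.
Qed.

Lemma conditioned_sum1 : \sum_G conditioned G = 1.
Proof. by rewrite -mulr_suml -big_mkcond divff // gt_eqF. Qed.

Lemma conditioned_neq0 G : conditioned G != 0 -> lgraph l G && A G.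
Proof. by rewrite /conditioned; case: ifP => // _; rewrite mul0r eqxx. Qed.

(** Jensen's inequality, from [ln (1 + u) <= u] at [u = f x / c - 1]. *)
Lemma expect_ln_le (Om : finType) (mu f : Om -> R) (c : R) :
    (forall x, 0 <= mu x) -> \sum_x mu x = 1 -> (forall x, 0 < f x) -> 0 < c ->
  expect mu f <= c -> expect mu (fun x => ln (f x)) <= ln c.
Proof.
move=> mu0 mu1 f0 c0 fc.
apply: (@le_trans _ _ (expect mu (fun x => ln c + (c^-1 * f x - 1)))).
  apply: le_expect => // x; rewrite -lerBlDl -ln_div ?posrE //.
  have -> : f x / c = 1 + (c^-1 * f x - 1) by ring.
  by apply: le_ln1Dx; rewrite ltrBrDr addNr mulr_gt0 ?invr_gt0.
rewrite expectD expectB expectZ /expect -mulr_suml mu1.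
under [X in _ - X]eq_bigr do rewrite mulr1.
rewrite mu1 mul1r gerDl subr_le0 mulrC ler_pdivrMr //.
by rewrite mul1r.
Qed.

Lemma ln_prod (I : finType) (P : pred I) (F : I -> R) : (forall i, 0 < F i) ->
  ln (\prod_(i | P i) F i) = \sum_(i | P i) ln (F i).
Proof.
move=> F0; suff [] : 0 < \prod_(i | P i) F i /\
  ln (\prod_(i | P i) F i) = \sum_(i | P i) ln (F i) by [].
apply: (big_ind2 (fun x y => 0 < x /\ ln x = y)) => //; first by rewrite ln1.
by move=> x1 y1 x2 y2 [x10 <-] [x20 <-]; rewrite mulr_gt0 // lnM.
Qed.

(** Density, with respect to [p], of the Bernoulli law that puts mass [1 - t] on
    the allowed outcome when only one of [r] (red) and [b] (blue) is allowed. *)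
Definition density (t : R) (r b x : bool) : R :=
  if r == b then 1
  else (if x == r then 1 - t else t) / (if x then p else 1 - p).

Lemma density_mean t r b :
  p * density t r b true + (1 - p) * density t r b false = 1.
Proof.
have p0 : p != 0 by rewrite gt_eqF.
have q0 : 1 - p != 0 by rewrite gt_eqF // subr_gt0.
by rewrite /density; case: r; case: b; rewrite /=; field; rewrite ?p0 ?q0.
Qed.

Variables (t : R) (t_gt0 : 0 < t) (t_lt1 : t < 1).

Lemma density_gt0 r b x : 0 < density t r b x.
Proof.
rewrite /density; case: ifP => // _; apply: divr_gt0; case: ifP => // _;
  by rewrite subr_gt0.
Qed.

(** Bounds the loss, against [edge_cost], at an edge of the wrong colour: there the
    density has numerator [t], and its denominator is that of the other colour. *)
Definition error_penalty : R := - (ln t + ln p + ln (1 - p)).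

Lemma error_penalty_ge0 : 0 <= error_penalty.
Proof.
have p0 : ln p <= 0 by rewrite ln_le0 ?ltW.
have q0 : ln (1 - p) <= 0 by rewrite ln_le0 // gerBl ltW.
have t0 : ln t <= 0 by rewrite ln_le0 ?ltW.
by rewrite /error_penalty; lra.
Qed.

Lemma ln_density_ge r b x :
  edge_cost p r b + ln (1 - t) -
    (if (r != b) && (x != r) then error_penalty else 0) <=
  ln (density t r b x).
Proof.
have p0 : ln p <= 0 by rewrite ln_le0 ?ltW.
have q0 : ln (1 - p) <= 0 by rewrite ln_le0 // gerBl ltW.
have t0 : ln (1 - t) <= 0 by rewrite ln_le0 // gerBl ltW.
have pP : p \is Num.pos by rewrite posrE.
have qP : 1 - p \is Num.pos by rewrite posrE subr_gt0.
have tP : t \is Num.pos by rewrite posrE.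
have sP : 1 - t \is Num.pos by rewrite posrE subr_gt0.
rewrite /density /edge_cost /error_penalty.
by case: r; case: b; case: x; rewrite /= ?ln1 ?ln_div //; lra.
Qed.

Variables (U : {set 'I_N}) (delta : R).
Hypothesis delta_ge0 : 0 <= delta.

Local Notation mu := conditioned.

Definition is_error e G : bool :=
  (allowed mu U delta true e G != allowed mu U delta false e G) &&
  ((e \in G) != allowed mu U delta true e G).

(** A colour is withheld only where its conditional probability is at most
    [delta], so it is met with probability at most [delta]. *)
Lemma expect_is_error e :
  expect mu (fun G => (is_error e G)%:R) <= 2 * delta.
Proof.
pose c G := edge_prob mu U e G.
have meas b : measurable_for (trace U)
    (fun G => (~~ allowed mu U delta b e G)%:R : R).
  by move=> G G' GG'; rewrite (measurable_allowed mu delta b e GG').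
have small b : expect mu (fun G => (~~ allowed mu U delta b e G)%:R *
    colour_prob b (c G)) <= delta.
  have const : delta = expect mu (fun=> delta).
    by rewrite /expect -mulr_suml conditioned_sum1 mul1r.
  rewrite [leRHS]const.
  apply: le_expect => [|G]; first exact: conditioned_ge0.
  rewrite /allowed -/(c G) negb_or negbK -leNgt.
  case: [disjoint _ & _]; last by rewrite mul0r.
  by case: (leP (colour_prob b (c G)) delta); rewrite /= ?mul0r ?mul1r.
have := lerD (small true) (small false); rewrite /colour_prob.
have red_c := expect_cond conditioned_ge0 (fun G => (e \in G)%:R) (meas true).
have blue_c := expect_cond conditioned_ge0 (fun G => (e \in G)%:R) (meas false).
have -> : expect mu (fun G => (~~ allowed mu U delta false e G)%:R * (1 - c G)) =
  expect mu (fun G => (~~ allowed mu U delta false e G)%:R * (1 - (e \in G)%:R)).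
  have mul1B (x y : R) : x * (1 - y) = x - x * y by ring.
  under eq_expect do rewrite mul1B; rewrite expectB blue_c -expectB.
  by apply: eq_expect => G; rewrite mul1B.
rewrite red_c -expectD => le2.
rewrite mulr2n mulrDl mul1r; apply: le_trans le2.
apply: le_expect => [|G]; first exact: conditioned_ge0.
rewrite /is_error; case: (allowed _ _ _ true _ _); case: (allowed _ _ _ _ _ _);
  case: (e \in G); rewrite /= ?mul0r ?mul1r ?subrr ?subr0 ?addr0 ?add0r //.
Qed.

(** Each possible trace [F] gives a colouring, hence a product law that follows it
    with error rate [t].  The sum of these laws over the [2 ^ #|EU|] possible traces
    dominates at every [G] the law attached to the trace of [G] itself.  So the
    density of the latter with respect to [G(N,p)] has mean at most
    [2 ^ #|EU| / Z] under [mu], and Jensen's inequality bounds the mean of its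
    logarithm, which is the mean cost up to the errors. *)
Lemma ln_Gnp_prob_le :
  ln Z <= #|[set e in L | ~~ [disjoint e & U]]|%:R * ln 2
    - \sum_(e in L) expect mu (cost_at p mu U delta e)
    - #|L|%:R * ln (1 - t) + #|L|%:R * (2 * delta) * error_penalty.
Proof.
set EU := [set e in L | ~~ [disjoint e & U]].
pose dens F G := \prod_(e in L)
  density t (allowed mu U delta true e F) (allowed mu U delta false e F) (e \in G).
have dens_gt0 F G : 0 < dens F G by apply: prodr_gt0 => e _; exact: density_gt0.
have dens_trace G : dens (trace U G) G = dens G G.
  apply: eq_bigr => e _; have tt := trace_subset G (subxx U).
  by rewrite !(measurable_allowed mu delta _ e tt).
have dens_sum F : \sum_(G | lgraph l G) Gnp_weight l p G * dens F G = 1.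
  under eq_bigr do rewrite -big_split /=.
  rewrite (sum_lgraph_prod (fun e x => (if x then p else 1 - p) *
    density t (allowed mu U delta true e F) (allowed mu U delta false e F) x)).
  by apply: big1 => e _; rewrite density_mean.
have mass : expect mu (fun G => dens G G) <= (2 ^ #|EU|)%:R / Z.
  have -> : expect mu (fun G => dens G G) = (\sum_G
      (if lgraph l G && A G then Gnp_weight l p G else 0) * dens G G) / Z.
    by rewrite mulr_suml; apply: eq_bigr => G _; rewrite /mu mulrAC.
  rewrite ler_pM2r ?invr_gt0 // -card_powerset.
  apply: (@le_trans _ _ (\sum_(F in powerset EU)
      \sum_(G | lgraph l G) Gnp_weight l p G * dens F G)); last first.
    by rewrite (eq_bigr (fun=> 1)) ?sumr_const // => F _; exact: dens_sum.
  rewrite exchange_big [leRHS]big_mkcond /=; apply: ler_sum => G _.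
  have nonneg F : 0 <= Gnp_weight l p G * dens F G.
    by rewrite mulr_ge0 ?Gnp_weight_ge0 // ltW.
  case: ifP => [/andP[GL _]|_].
    rewrite GL (bigD1 (trace U G)) /=.
      by rewrite dens_trace lerDl sumr_ge0.
    rewrite inE; apply/fintype.subsetP => e; rewrite !inE => /andP[eG ->].
    by move: (fintype.subsetP GL e eG); rewrite inE => ->.
  by rewrite mul0r; case: ifP => // _; rewrite sumr_ge0.
have c0 : 0 < (2 ^ #|EU|)%:R / Z by rewrite divr_gt0 // ltr0n expn_gt0.
have := expect_ln_le conditioned_ge0 conditioned_sum1 (fun G => dens_gt0 G G) c0 mass.
rewrite ln_div ?posrE ?ltr0n ?expn_gt0 // natrX lnXn // -[ln 2 *+ _]mulr_natl.
have dens_ge G : \sum_(e in L) (cost_at p mu U delta e G +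
    (ln (1 - t) - error_penalty * (is_error e G)%:R)) <= ln (dens G G).
  rewrite ln_prod; last by move=> e; exact: density_gt0.
  apply: ler_sum => e _; apply: le_trans (ln_density_ge _ _ _).
  rewrite /cost_at /is_error -addrA lerD2l lerD2l lerN2.
  by case: ifP => _; rewrite ?mulr1 ?mulr0.
move=> ln_le; have := le_trans (le_expect conditioned_ge0 dens_ge) ln_le.
rewrite expect_sum.
have term e : expect mu (fun G => cost_at p mu U delta e G +
    (ln (1 - t) - error_penalty * (is_error e G)%:R)) =
    expect mu (cost_at p mu U delta e) + (ln (1 - t) -
      error_penalty * expect mu (fun G => (is_error e G)%:R)).
  rewrite expectD expectB expectZ; congr (_ + (_ - _)).
  by rewrite /expect -mulr_suml conditioned_sum1 mul1r.
under eq_bigr do rewrite term.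
rewrite big_split sumrB sumr_const -[ln (1 - t) *+ _]mulr_natl -mulr_sumr /=.
have : error_penalty * (\sum_(e in L) expect mu (fun G => (is_error e G)%:R)) <=
    #|L|%:R * (2 * delta) * error_penalty.
  rewrite mulrC ler_wpM2r ?error_penalty_ge0 // mulr_natl -sumr_const.
  by apply: ler_sum => e _; exact: expect_is_error.
move: (_ * _ * error_penalty) (\sum_(e in L) _) (error_penalty * _).
move: (ln Z) (_ * ln 2) (_ * ln (1 - t)) => z u v bound costs errs.
move=> {c0 mass ln_le dens_ge dens_sum dens_gt0 dens_trace}; lra.
Qed.

End Conditioned.

(** * Counting edges that meet a vertex set *)

Lemma card_lsubsets (l N : nat) : #|lsubsets l [set: 'I_N]| = 'C(N, l).
Proof. by rewrite cards_draws cardsT card_ord. Qed.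

(** The edges avoiding [v] are the [l]-subsets of the [N - 1] other vertices, so by
    Pascal's rule ['C(N - 1, l - 1)] edges contain [v]. *)
Lemma card_edges_at (l N : nat) (v : 'I_N) :
  (N * #|[set e in lsubsets l [set: 'I_N] | v \in e]| = l * 'C(N, l))%N.
Proof.
have := cardsID [set e : {set 'I_N} | v \in e] (lsubsets l [set: 'I_N]).
have -> : lsubsets l [set: 'I_N] :\: [set e : {set 'I_N} | v \in e] =
    [set e : {set 'I_N} | e \subset [set~ v] & #|e| == l].
  apply/setP => e; rewrite !inE subsetT /=.
  by rewrite -disjoints1 disjoint_sym disjoints_subset.
have -> : lsubsets l [set: 'I_N] :&: [set e : {set 'I_N} | v \in e] =
    [set e in lsubsets l [set: 'I_N] | v \in e].
  by apply/setP => e; rewrite !inE.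
rewrite cards_draws card_lsubsets cardsC1 card_ord.
case: N v => [[] //|M] v /=.
case: l => [|l].
  by rewrite !bin0 => /eqP; rewrite (eqn_add2r 1 _ 0) => /eqP ->; rewrite muln0.
move=> count; rewrite -mul_bin_diag /=; congr (_ * _)%N; apply/eqP.
by rewrite -(eqn_add2r 'C(M, l.+1)) count binS addnC.
Qed.

Lemma card_edges_meeting (l N : nat) (U : {set 'I_N}) :
  (N * #|[set e in lsubsets l [set: 'I_N] | ~~ [disjoint e & U]]|
     <= #|U| * (l * 'C(N, l)))%N.
Proof.
set L := lsubsets l _.
have -> : (#|U| * (l * 'C(N, l)) = N * \sum_(v in U) #|[set e in L | v \in e]|)%N.
  rewrite big_distrr /= (eq_bigr (fun=> (l * 'C(N, l))%N)) ?sum_nat_const //.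
  by move=> v _; exact: card_edges_at.
rewrite leq_mul2l; apply/orP; right.
under eq_bigr do rewrite -sum1_card.
rewrite (exchange_big_dep (mem L)) /=; last by move=> v e _; rewrite inE => /andP[].
rewrite -sum1_card big_mkcond [leqRHS]big_mkcond /=; apply: leq_sum => e _.
rewrite inE; case: (boolP (e \in L)) => eL //=.
case: ifP => // /pred0Pn[v /= /andP[ve vU]].
by rewrite (bigD1 v) //= vU inE eL ve.
Qed.

(** * Induced-free hypergraphs *)

Section InducedFree.
Set Implicit Arguments.
Unset Strict Implicit.
Variables (l : nat) (V T : finType) (H : {set {set V}}).
Hypothesis HH : lgraph l H.
Implicit Types (G : {set {set T}}).

Lemma induced_free_embedding G (h : V -> T) : lgraph l G -> induced_free H G ->
    injective h ->
  exists2 e : {set V}, e \in lsubsets l [set: V] & (h @: e \in G) != (e \in H).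
Proof.
move=> GL /existsPn free hI; apply: contrapT => nex.
have same (e : {set V}) : e \in lsubsets l [set: V] -> (h @: e \in G) = (e \in H).
  by move=> eL; apply/eqP/negPn/negP => ne; apply: nex; exists e.
have /negP[] := free (h @: [set: V]); apply/existsP; exists [ffun x => h x].
have hE (e : {set V}) : [ffun x => h x] @: e = h @: e.
  by apply: eq_imset => x; rewrite ffunE.
apply/and3P; split; first by apply/injectiveP => x y; rewrite !ffunE => /hI.
  by rewrite hE.
apply/eqP/setP => E; rewrite inE; apply/andP/imsetP => [[EG EV]|[e eH ->]]; last first.
  by rewrite hE imsetS ?subsetT // same // (fintype.subsetP HH).
have hK : h @: (h @^-1: E) = E.
  apply/setP => y; apply/imsetP/idP => [[x]|yE]; first by rewrite inE => ? ->.
  have /imsetP[x _ yx] := fintype.subsetP EV _ yE.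
  by exists x; rewrite // inE -yx.
exists (h @^-1: E); last by rewrite hE hK.
rewrite -same ?hK // inE subsetT /= -(card_imset _ hI) hK.
by move: (fintype.subsetP GL _ EG); rewrite inE => /andP[].
Qed.

Lemma induced_free_relabel (s : {perm T}) G :
  induced_free H (relabel s G) = induced_free H G.
Proof.
have sub (s' : {perm T}) G' : induced_free H (relabel s' G') -> induced_free H G'.
  apply: contraNN => /existsP[W /existsP[h /and3P[/injectiveP hI /eqP hW hE]]].
  apply/existsP; exists (s' @: W); apply/existsP; exists [ffun x => s' (h x)].
  have hsE (e : {set V}) : [ffun x => s' (h x)] @: e = s' @: (h @: e).
    by rewrite -imset_comp; apply: eq_imset => x; rewrite ffunE.
  apply/and3P; split.
  - by apply/injectiveP => x y; rewrite !ffunE => /perm_inj/hI.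
  - by rewrite hsE hW.
  have -> : [set [ffun x => s' (h x)] @: (e : {set V}) | e in H] =
      relabel s' [set h @: (e : {set V}) | e in H].
    by rewrite /relabel -imset_comp; apply: eq_imset => e /=; rewrite hsE.
  rewrite -(eqP hE).
  apply/eqP/setP => E; rewrite -(imset_permKV s' E) inE !mem_relabel inE.
  congr (_ && _); apply/idP/idP => [|/imsetS//].
  by move/(imsetS (s'^-1)%g); rewrite !imset_permK.
apply/idP/idP; first exact: sub.
move=> free; apply: (sub (s^-1)%g); suff -> : relabel s^-1 (relabel s G) = G by [].
rewrite /relabel -imset_comp -[RHS]imset_id; apply: eq_imset => e /=.
exact: imset_permK.
Qed.

End InducedFree.

(** * Two-sided bound on the probability *)

Section ProbabilityBounds.
Set Implicit Arguments.
Unset Strict Implicit.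
Variables (R : realType) (l : nat) (p : R) (V : finType) (H : {set {set V}}).
Hypotheses (p_gt0 : 0 < p) (p_lt1 : p < 1) (HH : lgraph l H).

Definition free_prob (N : nat) : R :=
  @Gnp_prob R l p N (fun G => induced_free H G).

Definition valid (N : nat) (J : {set {set 'I_N}} * {set {set 'I_N}}) : bool :=
  (J.1 :|: J.2 == lsubsets l [set: 'I_N]) && ~~ coloured_sub l H J.

Lemma expR_ln_cost r b :
  (if r then p else 0) + (if b then 1 - p else 0) =
  if r || b then expR (- edge_cost p r b) else 0.
Proof.
have q_gt0 : 0 < 1 - p by rewrite subr_gt0.
rewrite /edge_cost; case: r; case: b; rewrite /= ?addr0 ?add0r ?oppr0 ?opprK //.
- by rewrite expR0 addrC subrK.
- by rewrite lnK.
- by rewrite lnK.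
Qed.

(** A hypergraph between [J_R \ J_B] and [J_R] obeys the colouring [J] everywhere,
    so its induced copies of [H] are copies in [J].  The product formula, with the
    factor 0 at each outcome that [J] forbids, sums over exactly these
    hypergraphs. *)
Lemma free_prob_ge (N : nat) (J : {set {set 'I_N}} * {set {set 'I_N}}) :
  valid J -> expR (- (H_p p J * ln 2)) <= free_prob N.
Proof.
case/andP => /eqP JL free; set L := lsubsets l _ in JL.
rewrite -(sum_edge_cost p JL) -sumrN expR_sum.
have -> : \prod_(e in L) expR (- edge_cost p (e \in J.1) (e \in J.2)) =
    \prod_(e in L) ((if e \in J.1 then p else 0) + (if e \in J.2 then 1 - p else 0)).
  by apply: eq_bigr => e; rewrite -JL expR_ln_cost inE => ->.
rewrite -(sum_lgraph_prod l (fun e x => if x then if e \in J.1 then p else 0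
  else if e \in J.2 then 1 - p else 0)).
rewrite /free_prob /Gnp_prob [leRHS]big_mkcondr /=; apply: ler_sum => G GL.
have [/forall_inP comp|] :=
  boolP [forall e in L, if e \in G then e \in J.1 else e \in J.2].
  have -> : induced_free H G.
    apply: contraNN free => /existsP[W HW]; apply/existsP; exists W.
    apply/existsP; exists (induced_on G W); rewrite HW /=; apply/andP; split.
      apply/fintype.subsetP => e; rewrite inE => /andP[eG _].
      by have := comp e (fintype.subsetP GL _ eG); rewrite eG.
    apply/fintype.subsetP => e; rewrite !inE => /andP[enG /andP[eW /eqP ce]].
    have eL : e \in L by rewrite inE subsetT ce eqxx.
    by have := comp e eL; move: enG; rewrite eW andbT => /negbTE ->.
  rewrite /Gnp_weight le_eqVlt; apply/orP; left; apply/eqP.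
  by apply: eq_bigr => e /comp; case: (e \in G) => ->.
rewrite negb_forall => /existsP[e]; rewrite negb_imply => /andP[eL ne].
rewrite (bigD1 e) //= [X in X * _](_ : _ = 0).
  by rewrite mul0r; case: ifP => // _; exact: Gnp_weight_ge0.
by move: ne; case: (e \in G) => /negbTE ->.
Qed.

Lemma oppr_log2_ge0 (x : R) : x <= 1 -> 0 <= - log2 x.
Proof.
move=> x1; rewrite -mulNr divr_ge0 ?oppr_ge0 ?ln_le0 //.
by apply: ln_ge0; rewrite ler1n.
Qed.

(** One colour everywhere avoids [H]: blue if [H] has an edge, and red if [H] has
    none but has room for one. *)
Lemma exists_valid (N : nat) : (l <= #|V|)%N ->
  exists2 J : {set {set 'I_N}} * {set {set 'I_N}}, valid J &
    H_p p J <= 'C(N, l)%:R * (- log2 p - log2 (1 - p)).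
Proof.
move=> lV; set L := lsubsets l [set: 'I_N].
have p0 : 0 <= - log2 p by exact: oppr_log2_ge0 (ltW p_lt1).
have q0 : 0 <= - log2 (1 - p) by apply: oppr_log2_ge0; rewrite gerBl ltW.
have [H0|/set0Pn[e eH]] := eqVneq H set0.
  exists (L, set0).
    rewrite /valid /= setU0 eqxx /=; apply/negP.
    case/coloured_sub_embedding => g _ gJ.
    have /card_gt0P[e eL] : (0 < #|lsubsets l [set: V]|)%N.
      by rewrite cards_draws cardsT bin_gt0.
    by have := gJ e eL; rewrite H0 !inE.
  rewrite /H_p /= setD0 set0D cards0 mul0r subr0 -mulrN card_lsubsets.
  by rewrite ler_wpM2l // lerDl.
exists (set0, L).
  rewrite /valid /= set0U eqxx /=; apply/negP.
  case/coloured_sub_embedding => g _ gJ.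
  by have := gJ e (fintype.subsetP HH _ eH); rewrite eH inE.
rewrite /H_p /= setD0 set0D cards0 mul0r oppr0 add0r -mulrN card_lsubsets.
by rewrite ler_wpM2l // lerDr.
Qed.

(** The parameters are chosen in the order [t] (rate of errors), [delta]
    (threshold of the colouring), [eta] (dependence between edges), [K] (number
    of levels) and [N]; the choices of [t], [delta], [eta] and [N] each bring one
    of four error terms below [eps / 4]. *)
Lemma ln_free_prob_le (N' : nat) (x eps : R) : (l <= #|V|)%N -> (l <= N')%N ->
    0 <= x -> 0 < eps ->
    (forall J : {set {set 'I_N'}} * {set {set 'I_N'}}, valid J ->
       x <= H_p p J * ln 2) ->
  exists N0, forall N, (N0 <= N)%N -> 0 < free_prob N ->
    ln (free_prob N) <= - (x / 'C(N', l)%:R - eps) * 'C(N, l)%:R.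
Proof.
move=> lV lN' x0 eps0 xmin.
set r := #|lsubsets l [set: V]|; set k := (#|V| - l)%N.
pose y : R := x / 'C(N', l)%:R.
have y0 : 0 <= y by rewrite divr_ge0.
pose t : R := 1 - expR (- (eps / 4)).
have ln_t : ln (1 - t) = - (eps / 4) by rewrite /t opprB addrC subrK expRK.
have t_gt0 : 0 < t by rewrite subr_gt0 expR_lt1 oppr_lt0 divr_gt0.
have t_lt1 : t < 1 by rewrite gtrBl expR_gt0.
pose pen := error_penalty p t.
have pen0 : 0 <= pen by exact: error_penalty_ge0.
pose delta : R := eps / (4 * eps + 8 * pen + 8).
have den0 : 0 < 4 * eps + 8 * pen + 8 by lra.
have delta_gt0 : 0 < delta by rewrite divr_gt0.
have delta_lt2 : delta < 2^-1 by rewrite ltr_pdivrMr //; lra.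
have delta_pen : 2 * delta * pen <= eps / 4.
  rewrite /delta mulrAC mulrA ler_pdivrMr //; nra.
pose c : R := y * (#|{ffun V -> 'I_N'}|%:R * (r%:R / delta ^+ r)).
have c0 : 0 <= c by rewrite !mulr_ge0 ?invr_ge0 ?exprn_ge0 // ltW.
pose eta : R := eps / (4 * (c + 1)).
have eta_gt0 : 0 < eta by rewrite divr_gt0 // mulr_gt0 // ltr_wpDl.
have c_eta : c * eta <= eps / 4.
  rewrite /eta mulrA ler_pdivrMr; last by rewrite mulr_gt0 // ltr_wpDl.
  by nra.
have [K K_gt0 K_eta] : exists2 K, (0 < K)%N & K%:R^-1 <= eta ^+ 2.
  exists (Num.bound (eta ^- 2)).+1 => //.
  rewrite -[leRHS]invrK lef_pV2 ?posrE ?ltr0n ?invr_gt0 ?exprn_gt0 //.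
  rewrite ltW // (lt_trans (archi_boundP _)) ?ltr_nat ?ltnSn //.
  by rewrite invr_ge0 sqr_ge0.
have ln2_gt0 : 0 < ln 2 :> R by rewrite ln_gt0 // ltr1n.
have [M M_ge] : exists M : nat,
    (K * k * l)%:R * (ln 2 + y) * 4 / eps <= M%:R.
  exists (Num.bound ((K * k * l)%:R * (ln 2 + y) * 4 / eps)).
  by rewrite ltW // archi_boundP // divr_ge0 ?mulr_ge0 ?addr_ge0 // ltW.
exists (maxn M (maxn (K * k + l) (maxn (K * k + N') 1))) => N.
rewrite !geq_max => /and4P[MN roomK roomN' N_gt0] Z_gt0.
rewrite -[N in (_ <= N)%N]card_ord in roomK.
pose mu := conditioned l p (fun G => induced_free H G) (N := N).
have mu_ge0 : forall G, 0 <= mu G by apply: conditioned_ge0.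
have mu_sum1 : \sum_G mu G = 1 by apply: conditioned_sum1.
have mu_exch (s : {perm 'I_N}) G : mu (relabel s G) = mu G.
  by apply: conditioned_exch => {}s {}G; exact: induced_free_relabel.
have [m mK stab] := stable_level mu_ge0 mu_sum1 mu_exch K_gt0 roomK.
have mN : (m <= N)%N.
  apply: leq_trans (leq_addr k m) _; apply: leq_trans mK _.
  exact: leq_trans (leq_addr _ _) roomN'.
(* [U] consists of the first [m] vertices, and [i] embeds ['I_N'] just after. *)
pose U : {set 'I_N} := [set widen_ord mN i | i : 'I_m].
have cU : #|U| = m.
  by rewrite card_imset ?card_ord // => i j /(congr1 val) /= /val_inj.
have ltU (i : 'I_N) : i \in U -> (i < m)%N.
  by case/imsetP => j _ ->; exact: (ltn_ord j).
have shift_lt (j : 'I_N') : (m + j < N)%N.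
  apply: leq_trans roomN'; rewrite -addnS leq_add //.
  exact: leq_trans (leq_addr _ _) mK.
pose i (j : 'I_N') : 'I_N := Ordinal (shift_lt j).
have iI : injective i by move=> j j' /(congr1 val) /= /addnI /val_inj.
have iU : [disjoint i @: [set: 'I_N'] & U].
  apply/pred0P => v /=; apply/negP => /andP[/imsetP[j _ ->] /ltU] /=.
  by rewrite ltnNge leq_addr.
have := ln_Gnp_prob_le p_gt0 p_lt1 Z_gt0 t_gt0 t_lt1 U (ltW delta_gt0).
rewrite -/(free_prob N) -/pen ln_t card_lsubsets.
set EU := [set e in _ | _]; set costs := \sum_(e in _) _ => bound.
have edge_ge e : e \in lsubsets l [set: 'I_N] :\: EU ->
    y - c * eta <= expect mu (cost_at p mu U delta e).
  rewrite !inE => /andP[/nandP eU /andP[_ /eqP ce]].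
  have {eU}deU : [disjoint e & U] by case: eU => [|/negPn//]; rewrite subsetT ce eqxx.
  have := expect_cost_at_ge p_gt0 p_lt1 mu_ge0 mu_sum1 mu_exch delta_gt0 delta_lt2
    eta_gt0 _ _ iI iU x0 _ ce deU.
  move=> /(_ V H) cost_ge.
  have {cost_ge} : x * (1 - #|{ffun V -> 'I_N'}|%:R * (r%:R * eta / delta ^+ r)) <=
      'C(N', l)%:R * expect mu (cost_at p mu U delta e).
    apply: cost_ge.
    - move=> U' e' UU' cU' ce' deU'; apply: le_trans K_eta.
      by apply: stab; rewrite ?cU' ?cU.
    - move=> G /conditioned_neq0 /andP[GL Gfree] h hI.
      exact: induced_free_embedding.
    - by move=> J JL Jfree; apply: xmin; rewrite /valid JL eqxx.
  have C0 : 0 < 'C(N', l)%:R :> R by rewrite ltr0n bin_gt0.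
  move=> cost_ge; apply: (@le_trans _ _ (x * (1 - #|{ffun V -> 'I_N'}|%:R *
      (r%:R * eta / delta ^+ r)) / 'C(N', l)%:R)); last first.
    by rewrite ler_pdivrMr // [leRHS]mulrC.
  rewrite le_eqVlt; apply/orP; left; apply/eqP; rewrite /c /y.
  have d0 : 0 < delta ^+ r by rewrite exprn_gt0.
  move: (delta ^+ r) d0 (_%:R) C0 (#|_|%:R) (r%:R) => d d0 C C0 D r'.
  by field; rewrite !gt_eqF.
have EU_small : #|EU|%:R * (ln 2 + y) <= 'C(N, l)%:R * (eps / 4).
  have N0 : 0 < N%:R :> R by rewrite ltr0n.
  have MN_R : M%:R <= N%:R :> R by rewrite ler_nat.
  have count : N%:R * #|EU|%:R <= (K * k * l)%:R * 'C(N, l)%:R :> R.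
    rewrite -!natrM ler_nat (leq_trans (card_edges_meeting l U)) // cU mulnA.
    by rewrite !leq_mul2r (leq_trans (leq_addr k m) mK) !orbT.
  rewrite -(ler_pM2l N0) [leLHS]mulrA.
  apply: (@le_trans _ _ ((K * k * l)%:R * 'C(N, l)%:R * (ln 2 + y))).
    by apply: ler_wpM2r => //; rewrite addr_ge0 // ltW.
  move: (le_trans M_ge MN_R); rewrite ler_pdivrMr // => le4.
  have C0 : 0 <= 'C(N, l)%:R :> R by exact: ler0n.
  have -> : (K * k * l)%:R * 'C(N, l)%:R * (ln 2 + y) =
      (K * k * l)%:R * (ln 2 + y) * 4 * 'C(N, l)%:R / 4.
    by move: (_%:R) (ln 2 + y) ('C(N, l)%:R) => a b C; field.
  have -> : N%:R * ('C(N, l)%:R * (eps / 4)) = N%:R * eps * 'C(N, l)%:R / 4.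
    by move: (N%:R) ('C(N, l)%:R) => a C; field.
  by rewrite ler_pM2r // ler_wpM2r.
have costs_ge : ('C(N, l)%:R - #|EU|%:R) * (y - c * eta) <= costs.
  have -> : 'C(N, l)%:R - #|EU|%:R = #|lsubsets l [set: 'I_N] :\: EU|%:R :> R.
    have EUL : EU \subset lsubsets l [set: 'I_N].
      by apply/fintype.subsetP => e; rewrite inE => /andP[].
    by rewrite cardsD (setIidPr EUL) natrB ?card_lsubsets // -card_lsubsets
      subset_leq_card.
  rewrite /costs (big_setID EU) /= mulr_natl -sumr_const.
  apply: (@le_trans _ _ (\sum_(e in lsubsets l [set: 'I_N] :\: EU)
      expect mu (cost_at p mu U delta e))).
    by apply: ler_sum => e; exact: edge_ge.
  rewrite lerDr sumr_ge0 // => e _; apply: sumr_ge0 => G _.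
  by apply: mulr_ge0; [exact: mu_ge0 | exact: edge_cost_ge0].
have n_ge0 : 0 <= 'C(N, l)%:R :> R by exact: ler0n.
have EU_ge0 : 0 <= #|EU|%:R * (c * eta).
  by apply: mulr_ge0; [exact: ler0n | exact: mulr_ge0 c0 (ltW eta_gt0)].
have := ler_wpM2l n_ge0 c_eta; have := ler_wpM2l n_ge0 delta_pen.
rewrite -/y; move: bound costs_ge EU_small EU_ge0.
move: (c * eta) (2 * delta) ('C(N, l)%:R) (#|EU|%:R) costs (ln _) (ln 2).
move=> ce d2 n u costs' z l2 {K_eta M_ge}.
lra.
Qed.

End ProbabilityBounds.

(** * Passage to the limit *)

Local Open Scope classical_set_scope.
Local Open Scope ring_scope.

Section Limit.
Set Implicit Arguments.
Unset Strict Implicit.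
Variable R : realType.

(** Up to any error [f] eventually exceeds each term of [g], hence its supremum,
    and [g] lies between [f] and this supremum. *)
Lemma cvg_sup_squeeze (f g : nat -> R) (n0 : nat) (b : R) :
    (forall n, (n0 <= n)%N -> f n <= g n <= b) ->
    (forall m eps, (n0 <= m)%N -> 0 < eps ->
       exists k, forall n, (k <= n)%N -> g m - eps <= f n) ->
  exists s : R, f n @[n --> \oo] --> s /\ g n @[n --> \oo] --> s.
Proof.
move=> fgb low; pose S := [set g n | n in [set n | (n0 <= n)%N]].
have supS : has_sup S.
  split; first by exists (g n0), n0 => /=.
  by exists b => _ [n /= /fgb /andP[_ ?] <-].
have below n : (n0 <= n)%N -> g n <= sup S.
  by move=> n0n; apply: sup_upper_bound => //; exists n.
have close eps : 0 < eps -> exists k, forall n, (k <= n)%N ->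
    [/\ sup S - eps <= f n, f n <= g n & g n <= sup S].
  move=> eps0; have e2 : 0 < eps / 2 by rewrite divr_gt0.
  have [_ [m /= n0m <-] gm] := sup_adherent e2 supS.
  have [k lowk] := low m _ n0m e2.
  exists (maxn n0 k) => n; rewrite geq_max => /andP[n0n kn].
  have /andP[fg _] := fgb n n0n; split; rewrite ?below //.
  by have := lowk n kn; lra.
exists (sup S); split; apply/cvgrPdist_le => eps eps0; have [k kP] := close eps eps0;
  exists k => // n /= /kP[low_n fg gs]; rewrite ler_norml; apply/andP; split; lra.
Qed.

Variables (l : nat) (p : R) (V : finType) (H : {set {set V}}).
Hypotheses (p_gt0 : 0 < p) (p_lt1 : p < 1) (HH : lgraph l H).

Lemma hex_p_attained (N : nat) : (l <= #|V|)%N ->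
  exists2 J : {set {set 'I_N}} * {set {set 'I_N}}, valid l H J &
    hex_p l p H N = (H_p p J)%:E /\
    forall J' : {set {set 'I_N}} * {set {set 'I_N}}, valid l H J' ->
      H_p p J <= H_p p J'.
Proof.
move=> lV; have [J0 vJ0 _] := exists_valid p_gt0 p_lt1 HH N lV.
have [J vJ Jmin] := arg_minP (H_p p (N := N)) vJ0.
exists J => //; split=> //; apply/le_anti/andP; split.
  exact: (bigmin_le_cond _ (fun J' => (@H_p R p N J')%:E)).
by apply/bigmin_geP; split; [exact: leey | move=> J' vJ'; rewrite lee_fin Jmin].
Qed.

(** With fewer than [l] vertices there are no edges to tell apart, so any
    [#|V|] vertices carry an induced copy. *)
Lemma small_copy (N : nat) : (#|V| < l)%N -> (#|V| <= N)%N ->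
  exists2 W : {set 'I_N}, is_copy H W finset.set0 & (#|W| < l)%N.
Proof.
move=> Vl VN.
have H0 : H = finset.set0.
  apply/eqP; rewrite -subset0; apply/fintype.subsetP => e /(fintype.subsetP HH).
  rewrite inE => /andP[_ /eqP ce]; have := max_card (mem e).
  by rewrite ce leqNgt Vl.
have hI : injective (fun v : V => widen_ord VN (enum_rank v)).
  by move=> v w /(congr1 val) /= /val_inj /enum_rank_inj.
pose h := [ffun v : V => widen_ord VN (enum_rank v)].
have {}hI : injective h by move=> v w; rewrite !ffunE => /hI.
exists (h @: [set: V]%SET); last by rewrite card_imset // cardsT.
apply/existsP; exists h; apply/and3P; split; rewrite ?eqxx //.
  exact/injectiveP.
by rewrite H0 imset0.
Qed.

Lemma free_prob_small (N : nat) : (#|V| < l)%N -> (#|V| <= N)%N ->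
  free_prob l p H N = 0.
Proof.
move=> Vl VN; have [W copyW cW] := small_copy Vl VN.
apply: big1 => G /andP[GL /existsPn /(_ W) /negP[]].
suff -> : induced_on G W = finset.set0 by [].
apply/eqP; rewrite -subset0; apply/fintype.subsetP => e; rewrite inE => /andP[eG eW].
move: (fintype.subsetP GL e eG); rewrite inE => /andP[_ /eqP ce].
by have := subset_leq_card eW; rewrite ce leqNgt cW.
Qed.

Lemma hex_p_small (N : nat) : (#|V| < l)%N -> (#|V| <= N)%N ->
  hex_p l p H N = +oo%E.
Proof.
move=> Vl VN; have [W copyW cW] := small_copy Vl VN.
apply: big_pred0 => J; apply/negbTE; rewrite negb_and negbK; apply/orP; right.
apply/existsP; exists W; apply/existsP; exists finset.set0.
rewrite copyW sub0set finset.setD0 /=; apply/fintype.subsetP => e.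
rewrite inE => /andP[eW /eqP ce].
by have := subset_leq_card eW; rewrite ce leqNgt cW.
Qed.

End Limit.

Theorem theorem2p7 (R : realType) (l : nat) (p : R) (V : finType)
    (H : {set {set V}}) (p_gt0 : 0 < p) (p_lt1 : p < 1) (HH : lgraph l H) :
  exists2 o : nat -> R, o n @[n --> \oo] --> (0 : R) &
    \forall N \near \oo,
      (@Gnp_prob R l p N (fun G => induced_free H G))%:E
      = pow2e (- (h_p l p H + (o N)%:E) * ('C(N, l)%:R)%:E)%E.
Proof.
have ln2_gt0 : 0 < ln 2 :> R by rewrite ln_gt0 // ltr1n.
have [lV|Vl] := leqP l #|V|; last first.
  have -> : h_p l p H = +oo%E :> \bar R.
    apply: lim_near_cst => //; exists (maxn #|V| l) => // N /=.
    rewrite geq_max => /andP[VN lN]; rewrite hex_p_small // gt0_mulye //.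
    by rewrite lte_fin invr_gt0 ltr0n bin_gt0.
  exists (fun=> 0); first exact: cvg_cst.
  exists (maxn #|V| l) => // N /=; rewrite geq_max => /andP[VN lN].
  rewrite -/(free_prob l p H N) free_prob_small // gt0_mulNye //.
  by rewrite lte_fin ltr0n bin_gt0.
pose hexR N := fine (hex_p l p H N : \bar R).
pose f N := - (ln (free_prob l p H N) / ln 2) / 'C(N, l)%:R : R.
pose g N := hexR N / 'C(N, l)%:R.
have hexR_attained N : exists2 J : {set {set 'I_N}} * {set {set 'I_N}},
    valid l H J & hexR N = H_p p J /\ forall J', valid l H J' -> hexR N <= @H_p R p N J'.
  have [J vJ [hexJ Jmin]] := hex_p_attained p_gt0 p_lt1 HH N lV.
  by exists J => //; rewrite /hexR hexJ.
have hexE N : hex_p l p H N = (hexR N)%:E.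
  by have [J _ [hexJ _]] := hex_p_attained p_gt0 p_lt1 HH N lV; rewrite /hexR hexJ.
have hexR_ge0 N : 0 <= hexR N * ln 2.
  have [J /andP[/eqP JL _] [-> _]] := hexR_attained N.
  by rewrite -(sum_edge_cost p JL) sumr_ge0 // => e _; exact: edge_cost_ge0.
have ln_ge N : - (hexR N * ln 2) <= ln (free_prob l p H N).
  have [J vJ [-> _]] := hexR_attained N.
  rewrite -[leLHS]expRK ler_ln ?posrE ?expR_gt0 ?free_prob_ge //.
  exact: lt_le_trans (expR_gt0 _) (free_prob_ge p_gt0 p_lt1 vJ).
have free_gt0 N : 0 < free_prob l p H N.
  have [J vJ _] := hexR_attained N.
  exact: lt_le_trans (expR_gt0 _) (free_prob_ge p_gt0 p_lt1 vJ).
have [||s [fs gs]] := @cvg_sup_squeeze R f g l (- log2 p - log2 (1 - p)).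
- move=> n l_n; have C0 : 0 < 'C(n, l)%:R :> R by rewrite ltr0n bin_gt0.
  apply/andP; split.
    rewrite ler_pM2r ?invr_gt0 // -mulNr ler_pdivrMr //.
    by rewrite lerNl ln_ge.
  have [J vJ J_le] := exists_valid p_gt0 p_lt1 HH n lV.
  have [_ _ [_ hexmin]] := hexR_attained n.
  by rewrite ler_pdivrMr // mulrC (le_trans (hexmin _ vJ)).
- move=> m eps lm eps0.
  have hex_min (J : {set {set 'I_m}} * {set {set 'I_m}}) : valid l H J ->
      hexR m * ln 2 <= H_p p J * ln 2.
    by move=> vJ; have [_ _ [_ hexmin]] := hexR_attained m; rewrite ler_pM2r ?hexmin.
  have [k kP] := ln_free_prob_le p_gt0 p_lt1 HH lV lm (hexR_ge0 m)
    (mulr_gt0 eps0 ln2_gt0) hex_min.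
  exists (maxn k l) => n; rewrite geq_max => /andP[kn l_n].
  have C0 : 0 < 'C(n, l)%:R :> R by rewrite ltr0n bin_gt0.
  have := kP n kn (free_gt0 n); rewrite /f /g => le_ln.
  rewrite ler_pdivlMr // lerNr ler_pdivrMr //; apply: le_trans le_ln _.
  rewrite le_eqVlt; apply/orP; left; apply/eqP.
  by rewrite mulrAC; move: (_%:R) (_^-1) => a b; ring.
have hpE : h_p l p H = s%:E.
  apply: cvg_lim => //.
  have -> : (fun N => hex_p l p H N * ('C(N, l)%:R^-1)%:E)%E = (fun N => (g N)%:E).
    by apply/funext => N; rewrite hexE -EFinM.
  by apply: cvg_EFin => //; exists 0%N.
exists (fun N => f N - s).
  by rewrite -(subrr s); apply: cvgB => //; exact: cvg_cst.
exists l => // N /= lN.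
have C0 : 'C(N, l)%:R != 0 :> R by rewrite pnatr_eq0 -lt0n bin_gt0.
rewrite hpE -EFinD -EFinN -EFinM /= addrC subrK /powR pnatr_eq0 /=.
congr (_%:E); rewrite -/(free_prob l p H N) -[LHS]lnK ?posrE //.
by congr expR; rewrite /f !mulNr opprK divfK // divfK // gt_eqF.
Qed.
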